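(* Let $\{X_n, n\ge 1\}$ be a strictly stationary sequence of real random variables with marginal distribution function $F$. Let $a_n>0$, $c_n>0$, $b_n,d_n\in\mathbb{R}$, put $u_n(x)=a_nx+b_n$ and $v_n(y)=c_ny+d_n$, and suppose that there are non-degenerate distribution functions $G$ and $H$ such that, for all $x,y\in\mathbb{R}$, $$\lim_{n\to\infty}F^n(u_n(x))=G(x),\qquad \lim_{n\to\infty}\big(\overline F(v_n(y))\big)^n=\overline H(y),$$ where $\overline F=1-F$ and $\overline H=1-H$. Let $x_1,x_2,y_1,y_2\in\mathbb{R}$ with $x_2<x_1$ and $y_2>y_1$. Assume that condition $D(u_n(x_1),v_n(y_1),u_n(x_2),v_n(y_2))$ holds and that condition $D'(u_n(x),v_n(y))$ holds for $(x,y)=(x_1,y_1)$ and $(x,y)=(x_2,y_2)$. Let $\boldsymbol{\varepsilon}=\{\varepsilon_n,n\ge1\}$ be a sequence of $\{0,1\}$-valued random variables which is independent of $\{X_n,n\ge1\}$ and such that $$\frac{1}{n}\sum_{i=1}^n\varepsilon_i\to\mathcal{P}\quad\text{in probability as } n\to\infty,$$ where $\mathcal{P}$ is a random variable with values in $[0,1]$ almost surely. Then $$\lim_{n\to\infty}\mathbb{P}\big\{v_n(y_2)<m_n(\boldsymbol{\varepsilon})\le M_n(\boldsymbol{\varepsilon})\le u_n(x_2),\ v_n(y_1)<m_n\le M_n\le u_n(x_1)\big\}=\mathbb{E}\Big\{G^{\mathcal{P}}(x_2)\,(\overline H(y_2))^{\mathcal{P}}\,G^{1-\mathcal{P}}(x_1)\,(\overline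 H(y_1))^{1-\mathcal{P}}\Big\}.$$
   Context: Notation. $M_n=\max_{1\le i\le n}X_i$ and $m_n=\min_{1\le i\le n}X_i$. $M_n(\boldsymbol{\varepsilon})=\max\{X_i:\varepsilon_i=1,\ i\le n\}$ if $\sum_{i=1}^n\varepsilon_i\ge1$, and $M_n(\boldsymbol{\varepsilon})=\inf\{x: F(x)>0\}$ otherwise. Similarly $m_n(\boldsymbol{\varepsilon})=\min\{X_i:\varepsilon_i=1,\ i\le n\}$ if $\sum_{i=1}^n\varepsilon_i\ge1$, and $m_n(\boldsymbol{\varepsilon})=\sup\{x:F(x)<1\}$ otherwise (these endpoints may be infinite). An event written ''$v<m\le M\le u$'' stands for ''$m>v$ and $M\le u$'' (the middle inequality is automatic unless no index is selected). Condition $D(u_n(x_1),v_n(y_1),u_n(x_2),v_n(y_2))$: there are positive integers $l_n$ with $l_n\to\infty$ and $l_n/n\to0$, and numbers $\alpha_{n,l_n}$ with $\lim_{n\to\infty}\alpha_{n,l_n}=0$, such that for every $n$ and all $A_1,A_2,B_1,B_2\subset\{1,\dots,n\}$ with $A_1\cap A_2=\emptyset$, $B_1\cap B_2=\emptyset$ and $b-a\ge l_n$ for all $a\in A_1\cup A_2$ and $b\in B_1\cup B_2$, $$\Big|\mathbb{P}\Big\{\bigcap_{j\in A_1\cup B_1}E_j^{(2)}\cap\bigcap_{j\in A_2\cup B_2}E_j^{(1)}\Big\}-\mathbb{P}\Big\{\bigcap_{j\in A_1}E_j^{(2)}\cap\bigcap_{j\in A_2}E_j^{(1)}\Big\}\,\mathbb{P}\Big\{\bigcap_{j\in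 B_1}E_j^{(2)}\cap\bigcap_{j\in B_2}E_j^{(1)}\Big\}\Big|\le\alpha_{n,l_n},$$ in each of the following three cases: (i) $E_j^{(i)}=\{v_n(y_i)<X_j\le u_n(x_i)\}$ for $i=1,2$; (ii) $E_j^{(i)}=\{X_j\le u_n(x_i)\}$ for $i=1,2$; (iii) $E_j^{(i)}=\{X_j>v_n(y_i)\}$ for $i=1,2$. Condition $D'(u_n(x),v_n(y))$: as $k\to\infty$, $$\limsup_{n\to\infty}\,n\sum_{j=1}^{[n/k]}\Big[\mathbb{P}\{X_1>u_n(x),X_{j+1}>u_n(x)\}+\mathbb{P}\{X_1>u_n(x),X_{j+1}\le v_n(y)\}+\mathbb{P}\{X_1\le v_n(y),X_{j+1}>u_n(x)\}+\mathbb{P}\{X_1\le v_n(y),X_{j+1}\le v_n(y)\}\Big]=o(1),$$ where $[\cdot]$ is the integer part. *)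

(* Defs.v *)
From HB Require Import structures.
From mathcomp Require Import all_boot all_order all_algebra.
From mathcomp Require Import all_classical all_reals all_analysis.

Set Implicit Arguments.
Unset Strict Implicit.
Unset Printing Implicit Defensive.

Import Order.TTheory GRing.Theory Num.Theory.
Import numFieldNormedType.Exports.

Local Open Scope classical_set_scope.
Local Open Scope ring_scope.

(* Sequences of random variables are indexed from 0: X i stands for the
   (i+1)-st variable of the mathematical sequence, so that the indices
   1, ..., n become the elements 0, ..., n-1 of 'I_n. Sequences of constants
   and of events (a, b, l, ...) keep their index n; n = 0 is never
   constrained. *)

Section probability_notions.
Context {d} {T : measurableType d} {R : realType} (P : probability T R).

Definition strictly_stationary (X : nat -> T -> R) : Prop :=
  forall (n h : nat) (B : set (n.-tuple R)), measurable B ->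
    P [set w | B [tuple X (h + i)%N w | i < n]] =
    P [set w | B [tuple X i w | i < n]].

Definition sigma_of_seq {d'} {U : measurableType d'} (Z : nat -> T -> U) :
    set_system T :=
  <<s \bigcup_i preimage_set_system [set: T] (Z i) measurable >>.

Definition independent_seqs {d1 d2} {U1 : measurableType d1}
    {U2 : measurableType d2} (Y : nat -> T -> U1) (Z : nat -> T -> U2) : Prop :=
  forall A B : set T, sigma_of_seq Y A -> sigma_of_seq Z B ->
    P (A `&` B) = (P A * P B)%E.

Definition cvg_in_probability (Y : nat -> T -> R) (Z : T -> R) : Prop :=
  forall e : R, 0 < e -> P [set w | e <= `|Y n w - Z w|] @[n --> \oo] --> 0%E.

End probability_notions.

Definition degenerate_df {R : realType} (G : R -> R) : Prop :=
  exists c : R, forall x : R, G x = (c <= x)%R%:R.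

Definition level {R : realType} (a b : nat -> R) (n : nat) (x : R) : R :=
  a n * x + b n.

Section extremes.
Context {T : Type} {R : realType}.
Local Open Scope ereal_scope.

(* For n = 0 (irrelevant to limits) these are -oo and +oo. *)
Definition maxX (X : nat -> T -> R) (n : nat) (w : T) : \bar R :=
  \big[maxe/-oo]_(i < n) (X i w)%:E.

Definition minX (X : nat -> T -> R) (n : nat) (w : T) : \bar R :=
  \big[mine/+oo]_(i < n) (X i w)%:E.

Definition selected_max (F : R -> R) (X : nat -> T -> R)
    (eps : nat -> T -> bool) (n : nat) (w : T) : \bar R :=
  if (0 < \sum_(i < n) eps i w)%N
  then \big[maxe/-oo]_(i < n | eps i w) (X i w)%:E
  else ereal_inf [set x%:E | x in [set x | (0 < F x)%R]].

Definition selected_min (F : R -> R) (X : nat -> T -> R)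
    (eps : nat -> T -> bool) (n : nat) (w : T) : \bar R :=
  if (0 < \sum_(i < n) eps i w)%N
  then \big[mine/+oo]_(i < n | eps i w) (X i w)%:E
  else ereal_sup [set x%:E | x in [set x | (F x < 1)%R]].

End extremes.

Section mixing_conditions.
Context {d} {T : measurableType d} {R : realType} (P : probability T R).
Local Open Scope ereal_scope.

Definition mixing_bound (n l : nat) (alpha : R) (E1 E2 : nat -> set T) : Prop :=
  let joint (I2 I1 : {set 'I_n}) : set T :=
    (\bigcap_(j in [set` I2]) E2 j) `&` (\bigcap_(j in [set` I1]) E1 j) in
  forall A1 A2 B1 B2 : {set 'I_n},
    (A1 :&: A2 = finset.set0)%SET -> (B1 :&: B2 = finset.set0)%SET ->
    (forall a b : 'I_n, a \in (A1 :|: A2)%SET -> b \in (B1 :|: B2)%SET ->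
      (a + l <= b)%N) ->
    `| P (joint (A1 :|: B1)%SET (A2 :|: B2)%SET)
       - P (joint A1 A2) * P (joint B1 B2) | <= alpha%:E.

(* ui n = u_n(x_i) and vi n = v_n(y_i), for i = 1, 2. *)
Definition condition_D (X : nat -> T -> R) (u1 v1 u2 v2 : nat -> R) : Prop :=
  exists (l : nat -> nat) (alpha : nat -> R),
    [/\ forall n, (0 < n)%N -> (0 < l n)%N,
        l n @[n --> \oo] --> \oo,
        ((l n)%:R / n%:R : R)%R @[n --> \oo] --> (0 : R)%R,
        alpha n @[n --> \oo] --> (0 : R)%R
      & forall n, (0 < n)%N ->
        [/\ mixing_bound n (l n) (alpha n)
              (fun j => [set w | (v1 n < X j w <= u1 n)%R])
              (fun j => [set w | (v2 n < X j w <= u2 n)%R]),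
            mixing_bound n (l n) (alpha n)
              (fun j => [set w | (X j w <= u1 n)%R])
              (fun j => [set w | (X j w <= u2 n)%R])
          & mixing_bound n (l n) (alpha n)
              (fun j => [set w | (v1 n < X j w)%R])
              (fun j => [set w | (v2 n < X j w)%R])]].

(* u n = u_n(x) and v n = v_n(y); n %/ k is the integer part of n/k. *)
Definition condition_D' (X : nat -> T -> R) (u v : nat -> R) : Prop :=
  limn_esup (fun n => n%:R%:E * \sum_(1 <= j < (n %/ k).+1)
    (P [set w | (u n < X 0%N w)%R /\ (u n < X j w)%R] +
     P [set w | (u n < X 0%N w)%R /\ (X j w <= v n)%R] +
     P [set w | (X 0%N w <= v n)%R /\ (u n < X j w)%R] +
     P [set w | (X 0%N w <= v n)%R /\ (X j w <= v n)%R]))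
  @[k --> \oo] --> 0.

End mixing_conditions.

(* Main.v *)
Require Import Defs.
From HB Require Import structures.
From mathcomp Require Import all_boot all_order all_algebra.
From mathcomp Require Import all_classical all_reals all_analysis.
From mathcomp Require Import measurable_realfun.
From mathcomp Require Import zify ring lra.

Import Order.TTheory GRing.Theory Num.Theory.
Import numFieldNormedType.Exports.

Local Open Scope classical_set_scope.
Local Open Scope ring_scope.

(** Call an index bad when its variable leaves the interval prescribed for it: the
    inner one ]v_n(y2), u_n(x2)] if the index is selected, the outer one
    ]v_n(y1), u_n(x1)] otherwise.  For large n the event of the theorem says that
    no index j < n is bad (selection_event_levels).

    For a deterministic selection this is a Poisson approximation.  Cut the n
    indices into k blocks.  Condition D makes successive blocks nearly independent,
    at the cost of short gaps (prob_avoid_step); within a block, the probability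
    of a bad index is the sum of the individual probabilities up to pair terms
    (prob_hit_ge), which condition D' controls.  Hence the probability that no
    index is bad is close to exp (- sum of the probabilities of being bad)
    (poisson_approximation), with an error that does not depend on which
    indices are selected.  If a fraction t of the indices is selected, the sum tends
    to t tau_2 + (1 - t) tau_1, where tau_i is the limit of n times the
    probability that an index is bad for the i-th pair of levels, uniformly over
    the selections (uniform_poisson_limit).

    The rates are tau_i = - ln G(x_i) - ln (1 - H y_i).  For this G(x_i) and
    1 - H y_i must be positive, and condition D' forces it: the Bonferroni
    inequality bounds n times the probability of being bad (rate_bounded), and
    with that bound F^n and exp (- n (1 - F)) have the same limit
    (cvg_rate_of_exprn).

    Since the selection is independent of the X_j, one may average the uniform
    estimate over the finitely many selection patterns (selection_average).  This
    replaces the probability by the expectation of a bounded Lipschitz function of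
    the selected fraction, and convergence in probability of that fraction to calP
    concludes (cvg_selection_event). *)

(** * Elementary estimates *)

Section real_estimates.
Context {R : realType}.
Implicit Types s t : R.

Lemma expRN_lipschitz s t : 0 <= s -> 0 <= t ->
  `|expR (- s) - expR (- t)| <= `|s - t|.
Proof.
wlog st : s t / s <= t.
  move=> H s0 t0; have [st|/ltW ts] := leP s t; first exact: H.
  by rewrite distrC (distrC s); exact: H.
move=> s0 t0.
have e1 : expR (- s) <= 1 by rewrite -expR0 ler_expR; lra.
have e2 : expR (- t) <= expR (- s) by rewrite ler_expR; lra.
have e3 : expR (- t) = expR (- s) * expR (- (t - s)).
  by rewrite -expRD; congr expR; ring.
have e4 := expR_ge1Dx (- (t - s)).
have e5 := expR_gt0 (- s).
rewrite ger0_norm; last lra.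
rewrite ler0_norm; last lra.
nra.
Qed.

Lemma expRN_quadratic s : 0 <= s -> `|1 - s - expR (- s)| <= s ^+ 2.
Proof.
move=> s0.
have e1 := expR_ge1Dx (- s).
have e2 := expR_ge1Dx s.
have e3 := expRxMexpNx_1 s.
have e4 := expR_gt0 (- s).
rewrite ler0_norm; last lra.
suff : expR (- s) <= 1 - s + s ^+ 2 by lra.
have : expR (- s) * (1 + s) <= 1 by nra.
have : 1 <= (1 - s + s ^+ 2) * (1 + s).
  have -> : (1 - s + s ^+ 2) * (1 + s) = 1 + s ^+ 3 by ring.
  by rewrite lerDl exprn_ge0.
move=> h1 h2; rewrite -(@ler_pM2r _ (1 + s)); lra.
Qed.

Lemma dist_exprn_le n s t : 0 <= s <= 1 -> 0 <= t <= 1 ->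
  `|s ^+ n - t ^+ n| <= n%:R * `|s - t|.
Proof.
move=> /andP[s0 s1] /andP[t0 t1].
elim: n => [|n IH]; first by rewrite !expr0 subrr normr0 mul0r.
have -> : s ^+ n.+1 - t ^+ n.+1 = s * (s ^+ n - t ^+ n) + (s - t) * t ^+ n.
  by rewrite !exprS; ring.
rewrite (le_trans (ler_normD _ _))// !normrM (ger0_norm s0).
rewrite [`|t ^+ n|]ger0_norm ?exprn_ge0// -natr1 mulrDl mul1r.
apply: lerD.
  by apply: le_trans IH; rewrite ler_piMl.
by rewrite ler_piMr// exprn_ile1.
Qed.

End real_estimates.

(** * Real-valued probabilities *)

(** Real numbers rather than extended ones, so that estimates of probabilities
    are ordinary linear arithmetic. *)
Definition prob {d} {T : measurableType d} {R : realType}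
  (P : probability T R) (A : set T) : R := fine (P A).

Section prob_theory.
Context {d} {T : measurableType d} {R : realType} (P : probability T R).
Implicit Types A B : set T.
Local Notation pr := (prob P).

Lemma probE A : measurable A -> P A = (pr A)%:E.
Proof. by move=> mA; rewrite fineK ?fin_num_measure. Qed.

Lemma prob_ge0 A : 0 <= pr A.
Proof. exact: fine_ge0. Qed.

Lemma prob_le1 A : measurable A -> pr A <= 1.
Proof. by move=> mA; rewrite -lee_fin -probE// probability_le1. Qed.

Lemma le_prob A B : measurable A -> measurable B -> A `<=` B -> pr A <= pr B.
Proof. by move=> mA mB AB; rewrite -lee_fin -!probE// le_measure ?inE. Qed.

Lemma probC A : measurable A -> pr (~` A) = 1 - pr A.
Proof.
move=> mA; have := probability_setC P mA.
by rewrite !probE//; [case|exact: measurableC].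
Qed.

Lemma probU A B : measurable A -> measurable B ->
  pr (A `|` B) = pr A + pr B - pr (A `&` B).
Proof.
move=> mA mB; have Bfin : (P B < +oo)%E by rewrite ltey_eq fin_num_measure.
have : P (A `|` B) = (P A + P B - P (A `&` B))%E by exact: measureUfinr.
by rewrite !probE//; [case|exact: measurableI|exact: measurableU].
Qed.

End prob_theory.

(** * Rare events along an interval of indices *)

Definition hit {T : Type} (B : nat -> set T) (s t : nat) : set T :=
  \bigcup_(j in [set j | (s <= j < t)%N]) B j.

Section rare_events.
Context {d} {T : measurableType d} {R : realType} (P : probability T R).
Variable B : nat -> set T.
Hypothesis mB : forall j, measurable (B j).
Local Notation pr := (prob P).

Lemma measurable_hit s t : measurable (hit B s t).
Proof. exact: bigcup_measurable. Qed.
Hint Resolve measurable_hit : core.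

Lemma measurable_avoid s t : measurable (~` hit B s t).
Proof. exact: measurableC. Qed.
Hint Resolve measurable_avoid : core.

Lemma hit_nil s : hit B s s = set0.
Proof. by apply/seteqP; split=> [w [j /=]|//]; lia. Qed.

Lemma hit_cat s t u : (s <= t <= u)%N -> hit B s u = hit B s t `|` hit B t u.
Proof.
move=> stu; apply/seteqP; split=> w /=.
  by case=> j /= jI Bj; have [jt|tj] := ltnP j t; [left|right]; exists j => //=; lia.
by case=> -[j /= jI Bj]; exists j => //=; lia.
Qed.

Lemma hit1 s : hit B s s.+1 = B s.
Proof.
apply/seteqP; split=> w /=; last by exists s => //=; lia.
by case=> j /= jI; have -> : j = s by lia.
Qed.

Lemma prob_hitI_le s r (A : set T) : measurable A ->
  pr (hit B s (s + r) `&` A) <= \sum_(s <= j < s + r) pr (B j `&` A).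
Proof.
move=> mA; elim: r => [|r IH].
  by rewrite addn0 hit_nil set0I big_geq// /prob measure0.
rewrite addnS big_nat_recr/= ?leq_addr//.
rewrite (@hit_cat _ (s + r)%N) ?hit1; last lia.
rewrite setIUl probU; [|exact: measurableI|exact: measurableI].
have := prob_ge0 P ((hit B s (s + r) `&` A) `&` (B (s + r)%N `&` A)); lra.
Qed.

Lemma prob_hit_le_sum s r :
  pr (hit B s (s + r)) <= \sum_(s <= j < s + r) pr (B j).
Proof.
have := prob_hitI_le s r _ measurableT.
by under eq_bigr do rewrite setIT; rewrite setIT.
Qed.

Lemma sum_prob_le s r (p : R) : (forall j, pr (B j) <= p) ->
  \sum_(s <= j < s + r) pr (B j) <= r%:R * p.
Proof.
move=> Bp; apply: le_trans (ler_sum _ (fun i _ => Bp _)) _.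
by rewrite sumr_const_nat addKn mulr_natl.
Qed.

Lemma prob_hit_le s r (p : R) : (forall j, pr (B j) <= p) ->
  pr (hit B s (s + r)) <= r%:R * p.
Proof.
by move=> Bp; exact: le_trans (prob_hit_le_sum s r) (sum_prob_le s r _ Bp).
Qed.

(** Second-order Bonferroni inequality: each index of the interval pairs with at
    most r earlier ones, at distances 1, ..., r. *)
Lemma prob_hit_ge s r m (q : nat -> R) : (r <= m)%N -> (forall h, 0 <= q h) ->
  (forall i h, (0 < h)%N -> pr (B i `&` B (i + h)%N) <= q h) ->
  \sum_(s <= j < s + r) pr (B j) - r%:R * \sum_(1 <= h < m.+1) q h <=
  pr (hit B s (s + r)).
Proof.
move=> + q0 Bq; elim: r => [_|r IH rm].
  by rewrite addn0 big_geq// mul0r subrr prob_ge0.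
rewrite addnS big_nat_recr/= ?leq_addr//.
rewrite (@hit_cat _ (s + r)%N) ?hit1; last lia.
rewrite probU// -natr1 mulrDl mul1r.
have overlap : pr (hit B s (s + r) `&` B (s + r)%N) <=
    \sum_(1 <= h < m.+1) q h.
  apply: (@le_trans _ _ (\sum_(1 <= h < r.+1) q h)); last first.
    rewrite [leRHS](@big_cat_nat _ _ _ r.+1)//= ?lerDl; last exact: ltnW.
    by apply: sumr_ge0.
  have -> : \sum_(1 <= h < r.+1) q h = \sum_(s <= i < s + r) q (s + r - i)%N.
    rewrite -{1}[s]add0n big_addn addKn big_add1/= big_nat_rev/= add0n.
    rewrite big_nat [RHS]big_nat.
    by apply: eq_bigr => i ir; congr q; lia.
  apply: le_trans (prob_hitI_le s r _ (mB _)) _.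
  rewrite big_nat [leRHS]big_nat; apply: ler_sum => i ir.
  have h0 : (0 < s + r - i)%N by lia.
  by have := Bq i _ h0; rewrite subnKC//; lia.
have := IH (ltnW rm); lra.
Qed.

(** When the indices before a block are separated from it by a gap of length l,
    the probability of no rare event nearly factorizes.  Removing the gap and
    putting it back costs l p each. *)
Lemma prob_avoid_step s r l (p alpha : R) :
  (forall j, pr (B j) <= p) -> 0 <= p ->
  `|pr (~` hit B 0 (s - l) `&` ~` hit B s (s + r)) -
    pr (~` hit B 0 (s - l)) * pr (~` hit B s (s + r))| <= alpha ->
  `|pr (~` hit B 0 (s + r)) - pr (~` hit B 0 s) * pr (~` hit B s (s + r))| <=
  alpha + 2 * (l%:R * p).
Proof.
move=> Bp p0 mix.
have gap : pr (hit B (s - l) s) <= l%:R * p.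
  have -> : hit B (s - l) s = hit B (s - l) ((s - l) + minn s l).
    by congr hit; lia.
  apply: le_trans (prob_hit_le _ _ _ Bp) _.
  by apply: ler_wpM2r => //; rewrite ler_nat geq_minr.
have cut (E : set T) : measurable E ->
    0 <= pr (~` hit B 0 (s - l) `&` E) - pr (~` hit B 0 s `&` E) <= l%:R * p.
  move=> mE; apply/andP; split.
    rewrite subr_ge0 le_prob//; [exact: measurableI|exact: measurableI|].
    apply: setSI; apply: subsetC.
    by rewrite (@hit_cat 0 (s - l)%N s); [exact: subsetUl|lia].
  rewrite lerBlDl; apply: (@le_trans _ _
      (pr ((~` hit B 0 s `&` E) `|` hit B (s - l) s))).
    rewrite le_prob//; [exact: measurableI| |].
      by apply: measurableU => //; exact: measurableI.
    move=> w [nh Ew]; rewrite (@hit_cat 0 (s - l)%N s); last lia.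
    have [|] := pselect (hit B (s - l) s w); first by right.
    by left; split=> //; case.
  rewrite probU//; last exact: measurableI.
  have := prob_ge0 P ((~` hit B 0 s `&` E) `&` hit B (s - l) s).
  lra.
have h1 := cut _ (measurable_avoid s (s + r)).
have h2 := cut _ (@measurableT _ T); rewrite !setIT in h2.
have e : ~` hit B 0 (s + r) = ~` hit B 0 s `&` ~` hit B s (s + r).
  by rewrite -setCU -hit_cat//; lia.
rewrite e.
have b0 := prob_ge0 P (~` hit B s (s + r)).
have b1 := prob_le1 P _ (measurable_avoid s (s + r)).
move: mix h1 h2; set a := pr (_ `&` _); set a' := pr (_ `&` _).
set c := pr (~` hit B 0 (s - l)); set c' := pr (~` hit B 0 s).
set b := pr (~` hit B s (s + r)) in b0 b1 *.
move=> mix /andP[h1 h1'] /andP[h2 h2'].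
have h3 : 0 <= (c - c') * b <= l%:R * p by apply/andP; split; nra.
move: mix h3; rewrite !ler_norml => /andP[m1 m2] /andP[h3 h3'].
apply/andP; split; nra.
Qed.

(** One more block: the block is avoided with probability close to 1 - S by
    Bonferroni, hence to exp (- S), where S is its expected number of rare
    events, and it is nearly independent of what precedes it.  The errors add
    up because all the factors lie in [0, 1]. *)
Lemma poisson_step (s r l m : nat) (p alpha : R) (q : nat -> R) (E : R) :
  (r <= m)%N -> (forall h, 0 <= q h) ->
  (forall i h, (0 < h)%N -> pr (B i `&` B (i + h)%N) <= q h) ->
  (forall j, pr (B j) <= p) -> 0 <= p ->
  `|pr (~` hit B 0 (s - l) `&` ~` hit B s (s + r)) -
    pr (~` hit B 0 (s - l)) * pr (~` hit B s (s + r))| <= alpha ->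
  `|pr (~` hit B 0 s) - expR (- \sum_(0 <= j < s) pr (B j))| <= E ->
  `|pr (~` hit B 0 (s + r)) - expR (- \sum_(0 <= j < s + r) pr (B j))| <=
  E + (alpha + 2 * (l%:R * p) + r%:R * \sum_(1 <= h < m.+1) q h
       + (r%:R * p) ^+ 2).
Proof.
move=> rm q0 Bq Bp p0 mix hE.
have step := prob_avoid_step _ _ _ _ _ Bp p0 mix.
rewrite (@big_cat_nat _ _ _ s)//= ?leq_addr//.
rewrite opprD expRD.
set S := \sum_(s <= j < s + r) pr (B j).
have S0 : 0 <= S by apply: sumr_ge0 => j _; exact: prob_ge0.
have Sp : S <= r%:R * p by exact: sum_prob_le.
have up : pr (hit B s (s + r)) <= S by exact: prob_hit_le_sum.
have low := prob_hit_ge s _ _ _ rm q0 Bq.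
rewrite -/S in low.
have e2 := expRN_quadratic _ S0.
have S2 : S ^+ 2 <= (r%:R * p) ^+ 2 by rewrite lerXn2r// nnegrE// mulr_ge0.
have pC := probC P _ (measurable_hit s (s + r)).
have c0 := prob_ge0 P (~` hit B 0 s).
have c1 := prob_le1 P _ (measurable_avoid 0 s).
have g0 : 0 < expR (- S) by exact: expR_gt0.
have g1 : expR (- S) <= 1 by rewrite -expR0 ler_expR; lra.
move: step hE low; rewrite pC.
set Q := r%:R * \sum_(1 <= h < m.+1) q h.
set x := pr (~` hit B 0 (s + r)); set c := pr (~` hit B 0 s) in c0 c1 *.
set h := pr (hit B s (s + r)) in up *; set g := expR (- S) in e2 g0 g1 *.
set e := expR (- \sum_(0 <= j < s) pr (B j)) => step hE low.
have -> : x - e * g = (x - c * (1 - h)) + c * (S - h) + c * (1 - S - g) + (c - e) * g.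
  by ring.
have t1 : `|c * (S - h)| <= Q.
  rewrite ger0_norm; [|apply: mulr_ge0; lra].
  by apply: (@le_trans _ _ (S - h)); [rewrite ler_piMl//; lra|lra].
have t2 : `|c * (1 - S - g)| <= (r%:R * p) ^+ 2.
  rewrite normrM (ger0_norm c0); apply: le_trans S2; apply: le_trans e2.
  by rewrite ler_piMl.
have t3 : `|(c - e) * g| <= E.
  rewrite normrM (ger0_norm (ltW g0)); apply: le_trans hE.
  by rewrite ler_piMr.
apply: le_trans (ler_normD _ _) _.
have := ler_normD (x - c * (1 - h) + c * (S - h)) (c * (1 - S - g)).
have := ler_normD (x - c * (1 - h)) (c * (S - h)).
lra.
Qed.

(** Induction over k blocks of length r; the n - k r remaining indices are
    neglected.  The error depends on the events through p, q and alpha only,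
    which is what makes the limit below uniform over the selections. *)
Lemma poisson_approximation (n k r l : nat) (p alpha : R) (q : nat -> R) :
  (k * r <= n)%N -> (forall h, 0 <= q h) ->
  (forall i h, (0 < h)%N -> pr (B i `&` B (i + h)%N) <= q h) ->
  (forall j, pr (B j) <= p) -> 0 <= p ->
  (forall s, (s + r <= n)%N ->
    `|pr (~` hit B 0 (s - l) `&` ~` hit B s (s + r)) -
      pr (~` hit B 0 (s - l)) * pr (~` hit B s (s + r))| <= alpha) ->
  `|pr (~` hit B 0 n) - expR (- \sum_(0 <= j < n) pr (B j))| <=
  k%:R * (alpha + 2 * (l%:R * p) + r%:R * \sum_(1 <= h < r.+1) q h
          + (r%:R * p) ^+ 2) + 2 * ((n - k * r)%:R * p).
Proof.
move=> krn q0 Bq Bp p0 mix.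
have main : `|pr (~` hit B 0 (k * r)) -
    expR (- \sum_(0 <= j < k * r) pr (B j))| <=
    k%:R * (alpha + 2 * (l%:R * p) + r%:R * \sum_(1 <= h < r.+1) q h
            + (r%:R * p) ^+ 2).
  elim: k krn => [_|k IH krn].
    rewrite mul0n hit_nil big_geq// setC0 oppr0 expR0 mul0r.
    by rewrite /prob probability_setT subrr normr0.
  rewrite mulSn addnC -natr1 mulrDl mul1r.
  apply: poisson_step => //; last by apply: IH; lia.
  by apply: mix; lia.
have eqS : \sum_(0 <= j < n) pr (B j) =
    \sum_(0 <= j < k * r) pr (B j) + \sum_(k * r <= j < n) pr (B j).
  by rewrite (@big_cat_nat _ _ _ (k * r)).
have s0 (i j : nat) : 0 <= \sum_(i <= h < j) pr (B h).
  by apply: sumr_ge0 => h _; exact: prob_ge0.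
have tail : \sum_(k * r <= j < n) pr (B j) <= (n - k * r)%:R * p.
  by have := sum_prob_le (k * r) (n - k * r) _ Bp; rewrite subnKC.
have lip := expRN_lipschitz _ _ (s0 0%N (k * r)%N) (s0 0%N n).
have rest : `|pr (~` hit B 0 n) - pr (~` hit B 0 (k * r))| <=
    (n - k * r)%:R * p.
  have := prob_hit_le (k * r) (n - k * r) _ Bp; rewrite subnKC// => ub.
  rewrite !probC// (@hit_cat 0 (k * r)%N n); last lia.
  have i0 := prob_ge0 P (hit B 0 (k * r) `&` hit B (k * r) n).
  have i1 : pr (hit B 0 (k * r) `&` hit B (k * r) n) <= pr (hit B (k * r) n).
    by apply: le_prob => //; exact: measurableI.
  by rewrite probU// ler_norml; apply/andP; split; lra.
have l2 : `|\sum_(0 <= j < k * r) pr (B j) - \sum_(0 <= j < n) pr (B j)| <=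
    (n - k * r)%:R * p.
  by rewrite eqS opprD addNKr normrN ger0_norm.
move: main lip rest l2.
set a := pr _; set b := pr _; set x := expR _; set y := expR _ => main lip rest l2.
have -> : b - y = (b - a) + (a - x) + (x - y) by ring.
have := ler_normD (b - a + (a - x)) (x - y).
have := ler_normD (b - a) (a - x).
lra.
Qed.

End rare_events.

(** * Limits *)

Section limits.
Context {R : realType}.

Lemma limn_esup_lt (u : nat -> \bar R) (e : \bar R) :
  (limn_esup u < e)%E -> \forall n \near \oo, (u n < e)%E.
Proof.
move=> /ereal_inf_lt[_ [V oV <-] supV].
apply: filterS oV => n Vn; apply: le_lt_trans supV.
by apply: ereal_sup_ubound; exists n.
Qed.

Lemma cvg_natrV : (n%:R^-1 : R) @[n --> \oo] --> (0 : R).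
Proof. by rewrite -cvg_shiftS; exact: cvg_harmonic. Qed.

(** Since (1 - s n)^n and exp(- n s n) differ by at most n (s n)^2, boundedness of
    n s n forces a positive limit and determines the limit of n s n. *)
Lemma cvg_rate_of_exprn (s : nat -> R) (C g : R) :
  (forall n, 0 <= s n <= 1) ->
  (\forall n \near \oo, n%:R * s n <= C) ->
  (1 - s n) ^+ n @[n --> \oo] --> g ->
  0 < g /\ n%:R * s n @[n --> \oo] --> - ln g.
Proof.
move=> s01 sC sg.
have C2 : C ^+ 2 / n%:R @[n --> \oo] --> (0 : R).
  rewrite -(mulr0 (C ^+ 2)); apply: cvgM; first exact: cvg_cst.
  exact: cvg_natrV.
have eg : expR (- (n%:R * s n)) @[n --> \oo] --> g.
  apply/cvgrPdist_lt => e e0.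
  have e20 : 0 < e / 2 by rewrite divr_gt0.
  move/cvgrPdist_lt: sg => /(_ _ e20) sg.
  move/cvgrPdist_lt: C2 => /(_ _ e20) C2.
  near=> n.
  have n0 : (0 < n)%N by near: n; exact: nbhs_infty_gt.
  have /andP[sn0 sn1] := s01 n.
  have h1 : `|g - (1 - s n) ^+ n| < e / 2 by near: n.
  have h2 : `|0 - C ^+ 2 / n%:R| < e / 2 by near: n.
  have h3 : n%:R * s n <= C by near: n.
  have nR : 0 < n%:R :> R by rewrite ltr0n.
  have x1 : expR (- (n%:R * s n)) = expR (- s n) ^+ n.
    by rewrite -expRM_natl mulrN.
  have e01 : 0 <= expR (- s n) <= 1.
    by rewrite expR_ge0 -expR0 ler_expR; lra.
  have h4 := dist_exprn_le n (1 - s n) (expR (- s n)) ltac:(lra) e01.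
  have h5 := expRN_quadratic _ sn0.
  have h6 : n%:R * s n ^+ 2 <= C ^+ 2 / n%:R.
    rewrite ler_pdivlMr//.
    have -> : n%:R * s n ^+ 2 * n%:R = (n%:R * s n) ^+ 2 by ring.
    have : 0 <= n%:R * s n by rewrite mulr_ge0.
    by move=> ?; rewrite lerXn2r// nnegrE; lra.
  rewrite x1.
  have h7 : n%:R * `|1 - s n - expR (- s n)| <= n%:R * s n ^+ 2.
    by rewrite ler_pM2l.
  have h8 : C ^+ 2 / n%:R < e / 2.
    by apply: le_lt_trans h2; rewrite sub0r normrN ler_norm.
  have -> : g - expR (- s n) ^+ n =
    (g - (1 - s n) ^+ n) + ((1 - s n) ^+ n - expR (- s n) ^+ n) by ring.
  apply: le_lt_trans (ler_normD _ _) _; lra.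
have g0 : 0 < g.
  apply: (@lt_le_trans _ _ (expR (- C))); first exact: expR_gt0.
  apply: (cvgr_to_ge eg).
  by apply: filterS sC => n /= h; rewrite ler_expR lerN2.
split=> //.
have lng : ln (expR (- (n%:R * s n))) @[n --> \oo] --> ln g.
  by apply: continuous_cvg => //; exact: continuous_ln.
rewrite (_ : (fun n => _) = fun n => - ln (expR (- (n%:R * s n)))).
  exact: cvgN.
by apply/funext => n; rewrite expRK opprK.
Unshelve. all: by end_near. Qed.

End limits.

(** * Poisson limit, uniformly over the selections *)

Section uniform_poisson.
Context {d} {T : measurableType d} {R : realType} (P : probability T R).
Local Notation pr := (prob P).
(* C n b j: the index j is bad at stage n, for the outer levels (b = false) or
   for the levels imposed on selected indices (b = true). *)
Variable C : nat -> bool -> nat -> set T.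
Hypothesis mC : forall n b j, measurable (C n b j).
Hypothesis C_sub : forall n b j, (0 < n)%N -> C n b j `<=` C n true j.
Variables (p : nat -> bool -> R) (q : nat -> nat -> R).
Hypothesis prob_C : forall n b j, pr (C n b j) = p n b.
Hypothesis prob_CI : forall n i h,
  pr (C n true i `&` C n true (i + h)%N) = q n h.
(* Two nearby indices are rarely bad together. *)
Hypothesis clusters : forall e : R, 0 < e -> exists K : nat, forall k,
  (K <= k)%N -> \forall n \near \oo,
  n%:R * \sum_(1 <= h < (n %/ k).+1) q n h <= e.

Definition mixed (n : nat) (e : nat -> bool) (j : nat) : set T := C n (e j) j.

Let mM n e j : measurable (mixed n e j).
Proof. exact: mC. Qed.

Let q0 n h : 0 <= q n h.
Proof. by rewrite -(prob_CI n 0 h) prob_ge0. Qed.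

Let p0 n b : 0 <= p n b.
Proof. by rewrite -(prob_C n b 0) prob_ge0. Qed.

Let p_le n b : (0 < n)%N -> p n b <= p n true.
Proof.
by move=> n0; rewrite -(prob_C n b 0) -(prob_C n true 0) le_prob//; exact: C_sub.
Qed.

(** By Bonferroni, r p <= 1 + r (q 1 + ... + q r) with r = n / k, and the right-hand
    side is bounded once clusters are excluded. *)
Lemma rate_bounded : exists M : R, \forall n \near \oo, n%:R * p n true <= M.
Proof.
have [K /(_ K.+1 (leqnSn K)) cK] := clusters _ (@ltr01 R).
exists (4 * K.+1%:R); near=> n.
have nK : (K.+1 <= n)%N by near: n; exact: nbhs_infty_ge.
have n0 : (0 < n)%N by lia.
have c1 : n%:R * \sum_(1 <= h < (n %/ K.+1).+1) q n h <= 1 by near: n.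
set k := K.+1 in c1 nK *; set r := (n %/ k)%N in c1.
have S0 : 0 <= \sum_(1 <= h < r.+1) q n h by apply: sumr_ge0.
have pair i h : (0 < h)%N ->
    pr (mixed n xpredT i `&` mixed n xpredT (i + h)%N) <= q n h.
  by rewrite prob_CI.
have := prob_hit_ge P _ (mM n xpredT) 0 _ _ _ (leqnn r) (q0 n) pair.
under eq_bigr do rewrite prob_C.
rewrite sumr_const_nat add0n subn0 -mulr_natl => low.
have hit1 := prob_le1 P _ (measurable_hit (mixed n xpredT) (mM n xpredT) 0 r).
have rn : r%:R <= n%:R :> R by rewrite ler_nat leq_div.
have rq : r%:R * \sum_(1 <= h < r.+1) q n h <= 1.
  by apply: le_trans c1; exact: ler_wpM2r.
have r1 : r%:R * p n true <= 2 by lra.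
have nkr : n%:R <= 2 * k%:R * r%:R :> R.
  rewrite -!natrM ler_nat.
  have r0 : (0 < r)%N by rewrite /r divn_gt0.
  have := ltn_ceil n (isT : (0 < k)%N); rewrite -/r; nia.
apply: (@le_trans _ _ (2 * k%:R * r%:R * p n true)); first exact: ler_wpM2r.
have -> : 2 * k%:R * r%:R * p n true = 2 * k%:R * (r%:R * p n true) by ring.
have -> : 4 * k%:R = 2 * k%:R * 2 :> R by ring.
by rewrite ler_wpM2l// mulr_ge0.
Unshelve. all: by end_near. Qed.

Variables (l : nat -> nat) (alpha : nat -> R) (tau : bool -> R).
Hypothesis gap_small : ((l n)%:R / n%:R : R) @[n --> \oo] --> (0 : R).
Hypothesis alpha0 : alpha n @[n --> \oo] --> (0 : R).
Hypothesis mixing : forall n e s t, (0 < n)%N -> (s <= t <= n)%N ->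
  `|pr (~` hit (mixed n e) 0 (s - l n) `&` ~` hit (mixed n e) s t) -
    pr (~` hit (mixed n e) 0 (s - l n)) * pr (~` hit (mixed n e) s t)| <=
  alpha n.
Hypothesis rate : forall b, n%:R * p n b @[n --> \oo] --> tau b.

Definition selected_fraction n (e : nat -> bool) : R :=
  (\sum_(i < n) (e i)%:R) / n%:R.

Lemma selected_fraction_itv n e : 0 <= selected_fraction n e <= 1.
Proof.
rewrite /selected_fraction; case: n => [|n]; first by rewrite big_ord0 mul0r lexx ler01.
rewrite divr_ge0 ?sumr_ge0//= ler_pdivrMr ?ltr0n// mul1r.
apply: le_trans (ler_sum _ (fun i _ => (_ : _ <= 1))) _.
  by move=> i _; case: (e i).
by rewrite sumr_const card_ord.
Qed.

Lemma sum_mixed n e : (0 < n)%N ->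
  \sum_(0 <= j < n) pr (mixed n e j) =
  selected_fraction n e * (n%:R * p n true) +
  (1 - selected_fraction n e) * (n%:R * p n false).
Proof.
move=> n0; rewrite big_mkord.
under eq_bigr do rewrite prob_C.
have nR : n%:R != 0 :> R by rewrite pnatr_eq0 -lt0n.
transitivity (\sum_(i < n) (p n false + (e i)%:R * (p n true - p n false))).
  by apply: eq_bigr => i _; case: (e i); rewrite ?mul1r ?mul0r; ring.
rewrite big_split/= sumr_const card_ord -mulr_suml -mulr_natl /selected_fraction.
by field.
Qed.

(** With r = n / k the error of the block approximation is at most
    k alpha + 2 k (l / n) (n p) + n (q 1 + ... + q r) + (n p)^2 / k + 2 k p.
    Choose k first, to make the third and fourth terms small for large n, and then
    n, which disposes of the others. *)
Lemma uniform_poisson_limit (eta : R) : 0 < eta ->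
  \forall n \near \oo, forall e : nat -> bool,
  `|pr (~` hit (mixed n e) 0 n) -
    expR (- (selected_fraction n e * tau true
             + (1 - selected_fraction n e) * tau false))| <= eta.
Proof.
move=> eta0.
have eta5 : 0 < eta / 5 by rewrite divr_gt0.
have tau0 b : 0 <= tau b.
  apply: (cvgr_to_ge (rate b)); apply: nearW => n.
  by rewrite mulr_ge0.
have [K cK] := clusters _ eta5.
have [k [kK kN kbig]] : exists k : nat,
    [/\ (K <= k)%N, (0 < k)%N & tau true ^+ 2 / k%:R < eta / 5].
  set z := tau true ^+ 2 / (eta / 5).
  exists (maxn K (Num.truncn z).+1).
  have kN : (0 < maxn K (Num.truncn z).+1)%N by rewrite (leq_trans _ (leq_maxr _ _)).
  split=> //; first exact: leq_maxl.
  rewrite ltr_pdivrMr ?ltr0n// mulrC -ltr_pdivrMr//.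
  apply: (@lt_le_trans _ _ (Num.truncn z).+1%:R); first exact: truncnS_gt.
  by rewrite ler_nat leq_maxr.
have {}cK := cK k kK.
have k0 : 0 < k%:R :> R by rewrite ltr0n.
pose x n : R := n%:R * p n true.
have xtau : x n @[n --> \oo] --> tau true by exact: rate.
pose err n := k%:R * alpha n + 2 * k%:R * ((l n)%:R / n%:R * x n)
  + x n ^+ 2 / k%:R + 2 * k%:R * (n%:R^-1 * x n).
have errE : err n @[n --> \oo] --> k%:R * 0 + 2 * k%:R * (0 * tau true)
    + tau true ^+ 2 / k%:R + 2 * k%:R * (0 * tau true).
  apply: cvgD; [apply: cvgD; [apply: cvgD|]|].
  - by apply: cvgM; [exact: cvg_cst|].
  - by apply: cvgM; [exact: cvg_cst|exact: cvgM].
  - by apply: cvgM; [exact: cvgM|exact: cvg_cst].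
  - by apply: cvgM; [exact: cvg_cst|apply: cvgM => //; exact: cvg_natrV].
have /cvgr_lt errlt := errE.
have {errlt} errlt := errlt (eta / 5) ltac:(by rewrite mul0r !mulr0 !add0r addr0).
have rT := rate true; have rF := rate false.
move/cvgrPdist_lt : rT => /(_ _ eta5) rT.
move/cvgrPdist_lt : rF => /(_ _ eta5) rF.
near=> n => e.
have n0 : (0 < n)%N by near: n; exact: nbhs_infty_gt.
have nR : 0 < n%:R :> R by rewrite ltr0n.
have c1 : n%:R * \sum_(1 <= h < (n %/ k).+1) q n h <= eta / 5 by near: n.
have c2 : err n < eta / 5 by near: n.
have c3 : `|tau true - n%:R * p n true| < eta / 5 by near: n.
have c4 : `|tau false - n%:R * p n false| < eta / 5 by near: n.
set r := (n %/ k)%N in c1.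
have krn : (k * r <= n)%N by rewrite mulnC leq_trunc_div.
have pair i h : (0 < h)%N ->
    pr (mixed n e i `&` mixed n e (i + h)%N) <= q n h.
  move=> _; rewrite -(prob_CI n i h) le_prob//; [exact: measurableI|exact: measurableI|].
  by apply: setISS; exact: C_sub.
have Bp j : pr (mixed n e j) <= p n true by rewrite prob_C p_le.
have mix s : (s + r <= n)%N ->
    `|pr (~` hit (mixed n e) 0 (s - l n) `&` ~` hit (mixed n e) s (s + r)) -
      pr (~` hit (mixed n e) 0 (s - l n)) * pr (~` hit (mixed n e) s (s + r))|
    <= alpha n.
  by move=> srn; apply: mixing => //; rewrite leq_addr.
have main := poisson_approximation P _ (mM n e) n k r (l n) _ _ _ krn (q0 n) pair Bp
  (p0 n true) mix.
have S0 : 0 <= \sum_(1 <= h < r.+1) q n h by apply: sumr_ge0.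
have bound : k%:R * (alpha n + 2 * ((l n)%:R * p n true) +
    r%:R * (\sum_(1 <= h < r.+1) q n h) + (r%:R * p n true) ^+ 2) +
    2 * ((n - k * r)%:R * p n true) <= 2 * (eta / 5).
  have krR : k%:R * r%:R <= n%:R :> R by rewrite -natrM ler_nat.
  have b1 : k%:R * (r%:R * (\sum_(1 <= h < r.+1) q n h)) <= eta / 5.
    by rewrite mulrA; apply: le_trans c1; exact: ler_wpM2r.
  have b2 : k%:R * (r%:R * p n true) ^+ 2 <= x n ^+ 2 / k%:R.
    rewrite ler_pdivlMr//.
    have -> : k%:R * (r%:R * p n true) ^+ 2 * k%:R = (k%:R * r%:R * p n true) ^+ 2.
      by ring.
    by rewrite lerXn2r// ?nnegrE ?mulr_ge0// ler_wpM2r.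
  have b3 : (n - k * r)%:R * p n true <= k%:R * (n%:R^-1 * x n).
    have -> : n%:R^-1 * x n = p n true by rewrite /x mulKf// gt_eqF.
    rewrite ler_wpM2r// ler_nat.
    by rewrite leq_subLR (mulnC k) addnC -mulSn; exact/ltnW/ltn_ceil.
  have b4 : (l n)%:R * p n true = (l n)%:R / n%:R * x n.
    by rewrite /x -mulrA mulKf// gt_eqF.
  rewrite !mulrDr b4; rewrite /err in c2.
  have -> : k%:R * (2 * ((l n)%:R / n%:R * x n)) =
            2 * k%:R * ((l n)%:R / n%:R * x n) by ring.
  lra.
have [t0 t1] := andP (selected_fraction_itv n e).
rewrite sum_mixed// in main.
move: (selected_fraction n e) t0 t1 main => t t0 t1 main.
have z0 (u v : R) : 0 <= u -> 0 <= v -> 0 <= t * u + (1 - t) * v.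
  by move=> ? ?; rewrite addr_ge0 ?mulr_ge0 ?subr_ge0.
have lip := expRN_lipschitz
  (t * (n%:R * p n true) + (1 - t) * (n%:R * p n false))
  (t * tau true + (1 - t) * tau false)
  ltac:(by apply: z0; rewrite mulr_ge0) ltac:(exact: z0).
have close : `|t * (n%:R * p n true) + (1 - t) * (n%:R * p n false) -
    (t * tau true + (1 - t) * tau false)| <= eta / 5.
  move: c3 c4; rewrite !ltr_norml ler_norml => /andP[? ?] /andP[? ?].
  by apply/andP; split; nra.
apply: le_trans (ler_distD (expR (- (t * (n%:R * p n true)
  + (1 - t) * (n%:R * p n false)))) _ _) _.
lra.
Unshelve. all: by end_near. Qed.

End uniform_poisson.

(** * Averaging over an independent selection *)

Section expectations.
Context {d} {T : measurableType d} {R : realType} (P : probability T R).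
Local Notation pr := (prob P).

Lemma integrable_itv01 (f : T -> R) : measurable_fun setT f ->
  (forall w, 0 <= f w <= 1) -> P.-integrable setT (EFin \o f).
Proof.
move=> mf f01; apply: measurable_bounded_integrable => //.
  by rewrite ltey_eq fin_num_measure.
exists 1; split; first exact: real1.
move=> x x1 w _ /=; have /andP[f0 f1] := f01 w.
by rewrite ger0_norm//; apply: le_trans f1 (ltW x1).
Qed.

(** The integrands differ by at most L delta off the event that the arguments are
    delta apart, and by at most 1 on it. *)
Lemma cvg_Rintegral_lipschitz (Z : nat -> T -> R) (Y : T -> R) (g : R -> R)
    (L : R) :
  (forall n, measurable_fun setT (Z n)) -> measurable_fun setT Y ->
  measurable_fun setT g -> (forall x, 0 <= g x <= 1) -> 0 < L ->
  (forall x y, `|g x - g y| <= L * `|x - y|) ->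
  cvg_in_probability P Z Y ->
  (\int[P]_w g (Z n w))%R @[n --> \oo] --> (\int[P]_w g (Y w))%R.
Proof.
move=> mZ mY mg g01 L0 gL ZY; apply/cvgrPdist_lt => e e0.
pose del := e / 2 / L.
have del0 : 0 < del by rewrite !divr_gt0.
pose A n := [set w | del <= `|Z n w - Y w|].
have mA n : measurable (A n).
  rewrite -[A n]setTI.
  apply: (measurable_fun_le _ (measurable_cst _)) => //.
  by apply: measurableT_comp => //; exact: measurable_funB.
have mgZ n : measurable_fun setT (g \o Z n) by exact: measurableT_comp.
have mgY : measurable_fun setT (g \o Y) by exact: measurableT_comp.
have igZ n : P.-integrable setT (EFin \o (g \o Z n)).
  by apply: integrable_itv01 => //= w; exact: g01.
have igY : P.-integrable setT (EFin \o (g \o Y)).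
  by apply: integrable_itv01 => //= w; exact: g01.
have iA n : P.-integrable setT (EFin \o (\1_(A n) : T -> R)).
  apply: integrable_itv01 => [|w]; first exact: measurable_indic.
  by rewrite indicE; case: (_ \in _); rewrite ?lexx ?ler01.
have ic (r : R) : P.-integrable setT (EFin \o (cst r : T -> R)).
  by apply: finite_measure_integrable_cst.
have ZYe : \forall n \near \oo, pr (A n) < e / 2.
  have /fine_cvgP[_ /cvgrPdist_lt H] := ZY _ del0.
  have e20 : 0 < e / 2 by rewrite divr_gt0.
  move: (H _ e20); apply: filterS => n /=.
  by rewrite sub0r normrN; apply: le_lt_trans; exact: ler_norm.
near=> n; have PA : pr (A n) < e / 2 by near: n.
rewrite distrC.
rewrite -(@RintegralB _ _ _ P setT (g \o Z n) (g \o Y))//.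
have iB : P.-integrable setT (EFin \o (fun w => g (Z n w) - g (Y w))).
  exact: (integrableB measurableT (igZ n) igY).
apply: le_lt_trans (le_normr_Rintegral measurableT iB) _.
apply: (@le_lt_trans _ _ (\int[P]_w (cst (e / 2) w + \1_(A n) w))%R).
  apply: le_Rintegral => //.
  - exact: (integrable_norm iB).
  - exact: (integrableD measurableT (ic _) (iA n)).
  move=> w _ /=; rewrite indicE; have [wA|wA] := boolP (w \in A n); last first.
    have h : `|Z n w - Y w| < del.
      by rewrite ltNge; apply: contra wA => wA; rewrite inE.
    rewrite addr0; apply: le_trans (gL _ _) _.
    by rewrite mulrC -ler_pdivlMr//; exact: ltW.
  have /andP[a0 a1] := g01 (Z n w); have /andP[b0 b1] := g01 (Y w).
  have : 0 < e / 2 by rewrite divr_gt0.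
  by rewrite mulr1n ler_norml => ?; apply/andP; split; lra.
rewrite RintegralD//.
have pT : pr setT = 1 by rewrite /prob probability_setT.
rewrite Rintegral_cst// [X in _ * X]pT mulr1.
have -> : (\int[P]_w \1_(A n) w)%R = pr (A n).
  by rewrite /Rintegral integral_indic// setIT.
lra.
Unshelve. all: by end_near. Qed.

(** Partition the space by the values of a finite-valued map. *)
Lemma average_over_fibers (I : finType) (phi : T -> I) (A : set T)
    (f g : I -> R) (e : R) :
  (forall i, measurable (phi @^-1` [set i])) ->
  (forall i, measurable (A `&` phi @^-1` [set i])) ->
  (forall i, pr (A `&` phi @^-1` [set i]) = f i * pr (phi @^-1` [set i])) ->
  (forall i, 0 <= g i <= 1) ->
  (forall i, `|f i - g i| <= e) ->
  `|pr A - (\int[P]_w g (phi w))%R| <= e.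
Proof.
move=> mphi mA Af g01 fg.
have tphi : trivIset setT (fun i => phi @^-1` [set i]).
  by move=> i j _ _ [w [/= -> ->]].
have sumP (B : set T) : (forall i, measurable (B `&` phi @^-1` [set i])) ->
    pr B = \sum_i pr (B `&` phi @^-1` [set i]).
  move=> mB.
  have -> : pr B = pr (\bigcup_(i in [set` enum I]) (B `&` phi @^-1` [set i])).
    congr prob; apply/seteqP; split=> w; last by case=> i _ [].
    by move=> Bw; exists (phi w) => //=; rewrite mem_enum.
  rewrite /prob measure_fin_bigcup//; last first.
    by apply: trivIset_setIl; apply: sub_trivIset tphi.
  rewrite -fsbig_seq ?enum_uniq// big_enum/=; under eq_bigr do rewrite probE//.
  by rewrite sumEFin/=; apply: eq_bigl.
have intE : (\int[P]_w g (phi w))%R = \sum_i g i * pr (phi @^-1` [set i]).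
  pose ind i : T -> R := \1_(phi @^-1` [set i]).
  have intI i : (\int[P]_w (ind i w)%:E)%E = (pr (phi @^-1` [set i]))%:E.
    by rewrite integral_indic// setIT; exact: probE.
  have phiE w : (g (phi w))%:E = (\sum_(i : I) (g i * ind i w)%:E)%E.
    rewrite sumEFin (bigD1 (phi w))//= big1 ?addr0.
      by rewrite /ind indicE mem_set// mulr1.
    move=> i ni; rewrite /ind indicE memNset ?mulr0//= => h.
    by rewrite h eqxx in ni.
  have ind0 i w : 0 <= ind i w by rewrite /ind indicE.
  have mind i : measurable_fun setT (ind i) by exact: measurable_indic.
  clearbody ind; rewrite /Rintegral.
  under eq_integral do rewrite phiE.
  rewrite ge0_integral_sum//=.
  - under eq_bigr => i _.
      under eq_integral do rewrite EFinM.
      rewrite ge0_integralZl//; last 3 first.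
      - exact/measurable_EFinP.
      - by move=> w _; rewrite lee_fin.
      - by have /andP[] := g01 i.
      rewrite intI -EFinM.
      over.
    by rewrite sumEFin.
  - by move=> i; apply/measurable_EFinP; apply: measurable_funM.
  - by move=> i w _; rewrite lee_fin mulr_ge0//; have /andP[] := g01 i.
have one : \sum_i pr (phi @^-1` [set i]) = 1.
  have mT i : measurable (setT `&` phi @^-1` [set i]) by rewrite setTI.
  transitivity (pr setT); last by rewrite /prob probability_setT.
  by rewrite (sumP _ mT); under [RHS]eq_bigr do rewrite setTI.
rewrite (sumP _ mA) intE -sumrB.
apply: le_trans (ler_norm_sum _ _ _) _.
rewrite -[leRHS]mulr1 -one mulr_sumr; apply: ler_sum => i _.
by rewrite Af -mulrBl normrM (ger0_norm (prob_ge0 _ _)) ler_wpM2r// prob_ge0.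
Qed.

End expectations.

Section generated_sigma_algebra.
Context {d} {T : measurableType d} {d'} {U : measurableType d'}.
Variable Z : nat -> T -> U.

Lemma sigma_of_seq_preimage i (B : set U) :
  measurable B -> sigma_of_seq Z (Z i @^-1` B).
Proof.
move=> mB; apply: sub_sigma_algebra; exists i => //.
by exists B => //; rewrite setTI.
Qed.

Lemma sigma_of_seq_avoid (B : nat -> set T) s t :
  (forall j, sigma_of_seq Z (B j)) -> sigma_of_seq Z (~` hit B s t).
Proof.
move=> ZB.
pose G := \bigcup_i preimage_set_system [set: T] (Z i) measurable.
have mB j : @measurable _ (g_sigma_algebraType G) (B j) by exact: ZB.
have : @measurable _ (g_sigma_algebraType G) (~` hit B s t).
  by apply: measurableC; apply: bigcup_measurable => j _; exact: mB.
by [].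
Qed.

End generated_sigma_algebra.

Section independent_selection.
Context {d} {T : measurableType d} {R : realType} (P : probability T R).
Local Notation pr := (prob P).
Variables (C : nat -> bool -> nat -> set T) (X : nat -> T -> R).
Variable eps : nat -> T -> bool.
Hypothesis mC : forall n b j, measurable (C n b j).
Hypothesis XC : forall n b j, sigma_of_seq X (C n b j).
Hypothesis meps : forall i, measurable_fun setT (eps i).
Hypothesis indep : independent_seqs P eps X.

Definition selection_event n : set T :=
  [set w | (~` hit (mixed C n (eps ^~ w)) 0 n) w].

Lemma measurable_selection_event n : measurable (selection_event n).
Proof.
pose D j := C n true j `&` eps j @^-1` [set true] `|`
            C n false j `&` eps j @^-1` [set false].
have -> : selection_event n = ~` hit D 0 n.
  apply/seteqP; split=> w nh [j jn Dj]; apply: nh; exists j => //; move: Dj.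
    by rewrite /D /mixed => -[[Cj /= ->]|[Cj /= ->]].
  by rewrite /D /mixed; case ej : (eps j w) => Cj; [left|right].
have meps' j t : measurable (eps j @^-1` [set t]).
  by rewrite -[X in measurable X]setTI; exact: meps.
apply: measurable_avoid => j.
by apply: measurableU; apply: measurableI.
Qed.

(** Conditionally on the first n selection variables the selection is
    deterministic, so an estimate uniform over deterministic selections
    survives averaging. *)
Lemma selection_average (n : nat) (eta : R) (g : R -> R) :
  (forall x, 0 <= g x <= 1) ->
  (forall e, `|pr (~` hit (mixed C n e) 0 n) - g (selected_fraction n e)|
             <= eta) ->
  `|pr (selection_event n) -
    (\int[P]_w g (selected_fraction n (eps ^~ w)))%R| <= eta.
Proof.
move=> g01 close.
pose phi w : n.-tuple bool := [tuple eps i w | i < n].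
pose sel (t : n.-tuple bool) : nat -> bool := nth false t.
pose off (t : n.-tuple bool) j := eps j @^-1` [set ~~ sel t j].
have selphi w (i : nat) : (i < n)%N -> sel (phi w) i = eps i w.
  move=> ni; rewrite /sel -[i]/(nat_of_ord (Ordinal ni)) -tnth_nth.
  by rewrite tnth_mktuple.
have fiberE t : phi @^-1` [set t] = ~` hit (off t) 0 n.
  apply/seteqP; split=> w /=.
    by move=> <- [j /= jn]; rewrite /off /= selphi//; case: (eps j w).
  move=> nh; apply: eq_from_tnth => i; rewrite tnth_mktuple (tnth_nth false).
  apply: contrapT => /eqP ni; apply: nh; exists (nat_of_ord i) => //=.
  by move: ni; rewrite /off/= /sel; case: (eps i w); case: (nth _ _ _).
have moff t j : measurable (off t j) by rewrite -[off t j]setTI; exact: meps.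
have mM t j : measurable (mixed C n (sel t) j) by exact: mC.
have interE t : selection_event n `&` phi @^-1` [set t] =
    phi @^-1` [set t] `&` ~` hit (mixed C n (sel t)) 0 n.
  have same w j : phi w = t -> (0 <= j < n)%N ->
      mixed C n (eps ^~ w) j = mixed C n (sel t) j.
    by move=> <- jn; rewrite /mixed selphi.
  apply/seteqP; split=> w /= [].
    move=> nh ft; split=> // -[j jn]; rewrite -(same w)// => Mw.
    by apply: nh; exists j.
  move=> ft nh; split=> // -[j jn]; rewrite (same w)// => Mw.
  by apply: nh; exists j.
have mfib t : measurable (phi @^-1` [set t]).
  by rewrite fiberE; apply: measurable_avoid.
have -> : (\int[P]_w g (selected_fraction n (eps ^~ w)))%R =
          (\int[P]_w g (selected_fraction n (sel (phi w))))%R.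
  apply: eq_Rintegral => w _; congr g; rewrite /selected_fraction; congr (_ / _).
  by apply: eq_bigr => i _; rewrite selphi.
apply: (average_over_fibers P _ phi _
  (fun t => pr (~` hit (mixed C n (sel t)) 0 n))
  (fun t => g (selected_fraction n (sel t)))) => //.
- by move=> t; rewrite interE; apply: measurableI => //; exact: measurable_avoid.
- move=> t; rewrite interE.
  have seps : sigma_of_seq eps (phi @^-1` [set t]).
    by rewrite fiberE; apply: sigma_of_seq_avoid => j; exact: sigma_of_seq_preimage.
  have sX : sigma_of_seq X (~` hit (mixed C n (sel t)) 0 n).
    by apply: sigma_of_seq_avoid => j; exact: XC.
  have := indep _ _ seps sX.
  rewrite !probE//; first by case=> ->; rewrite mulrC.
  - exact: measurable_avoid.
  - by apply: measurableI => //; exact: measurable_avoid.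
Qed.

(** Lipschitz continuity turns the convergence in probability of the selected
    fraction into convergence of the averages. *)
Lemma cvg_selection_event (Y : T -> R) (g : R -> R) (L : R) :
  measurable_fun setT Y ->
  measurable_fun setT g -> (forall x, 0 <= g x <= 1) -> 0 < L ->
  (forall x y, `|g x - g y| <= L * `|x - y|) ->
  cvg_in_probability P (fun n w => selected_fraction n (eps ^~ w)) Y ->
  (forall eta, 0 < eta -> \forall n \near \oo, forall e,
    `|pr (~` hit (mixed C n e) 0 n) - g (selected_fraction n e)| <= eta) ->
  pr (selection_event n) @[n --> \oo] --> (\int[P]_w g (Y w))%R.
Proof.
move=> mY mg g01 L0 gL ZY close.
have mZ n : measurable_fun setT (fun w => selected_fraction n (eps ^~ w) : R).
  apply: measurable_funM; last exact: measurable_cst.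
  apply: measurable_sum => i.
  by apply: (@measurableT_comp _ _ _ _ _ _ (fun b : bool => b%:R : R)).
have := cvg_Rintegral_lipschitz P _ _ _ _ mZ mY mg g01 L0 gL ZY.
move=> /cvgrPdist_lt icvg; apply/cvgrPdist_lt => e e0.
have e20 : 0 < e / 2 by rewrite divr_gt0.
near=> n.
have h1 : `|(\int[P]_w g (Y w))%R -
    (\int[P]_w g (selected_fraction n (eps ^~ w)))%R| < e / 2.
  by near: n; exact: icvg.
have h2 : forall f,
    `|pr (~` hit (mixed C n f) 0 n) - g (selected_fraction n f)| <= e / 2.
  by near: n; exact: close.
have := selection_average n _ _ g01 h2.
move: h1; set x := Rintegral _ _ _; set y := Rintegral _ _ _.
rewrite [`|pr _ - _|]distrC => h1 {}h2.
apply: le_lt_trans (ler_distD y _ _) _; lra.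
Unshelve. all: by end_near. Qed.

End independent_selection.

(** * Exceedances of two pairs of levels *)

Section levels.
Context {d} {T : measurableType d} {R : realType} (P : probability T R).
Local Notation pr := (prob P).
Variables (X : nat -> {RV P >-> R}) (F : R -> R).
Hypothesis stationary : strictly_stationary P X.
Hypothesis marginal : forall i x, cdf (X i) x = (F x)%:E.
Variables u v : bool -> nat -> R.

Definition bad n b j : set T := ~` [set w | v b n < X j w <= u b n].

Let bad_preimage n b j : bad n b j = X j @^-1` (~` `]v b n, u b n]).
Proof.
by apply/seteqP; split=> w /=; rewrite in_itv.
Qed.

Lemma measurable_bad n b j : measurable (bad n b j).
Proof.
rewrite bad_preimage -[X in measurable X]setTI.
by apply: measurable_funP => //; exact: measurableC.
Qed.

Lemma sigma_of_seq_bad n b j : sigma_of_seq X (bad n b j).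
Proof.
by rewrite bad_preimage; apply: sigma_of_seq_preimage; exact: measurableC.
Qed.

Lemma stationary_pair (A B : set R) i h : measurable A -> measurable B ->
  pr ((X i @^-1` A) `&` (X (i + h)%N @^-1` B)) =
  pr ((X 0%N @^-1` A) `&` (X h @^-1` B)).
Proof.
move=> mA mB.
pose S : set (h.+1.-tuple R) :=
  ((fun t => tnth t ord0) @^-1` A) `&` ((fun t => tnth t ord_max) @^-1` B).
have mS : measurable S.
  apply: measurableI.
    by rewrite -[X in measurable X]setTI; exact: measurable_tnth.
  by rewrite -[X in measurable X]setTI; exact: measurable_tnth.
have := stationary h.+1 i S mS; rewrite /prob => /(congr1 fine).
have shiftE m : [set w | S [tuple X (m + i0)%N w | i0 < h.+1]] =
    (X m @^-1` A) `&` (X (m + h)%N @^-1` B).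
  by apply/seteqP; split=> w; rewrite /S /= !tnth_mktuple /= addn0.
rewrite shiftE => ->.
by have := shiftE 0%N; rewrite add0n => <-.
Qed.

Lemma stationary_bad n b j : pr (bad n b j) = pr (bad n b 0).
Proof.
have := stationary_pair (~` `]v b n, u b n]) setT j 0.
by rewrite !preimage_setT !setIT -!bad_preimage; apply; [exact: measurableC|].
Qed.

Lemma stationary_badI n i h :
  pr (bad n true i `&` bad n true (i + h)%N) =
  pr (bad n true 0 `&` bad n true h).
Proof.
by rewrite !bad_preimage; apply: stationary_pair; exact: measurableC.
Qed.

Lemma measurable_X_le j x : measurable [set w | X j w <= x].
Proof.
have -> : [set w | X j w <= x] = X j @^-1` `]-oo, x].
  by apply/seteqP; split=> w /=; rewrite in_itv.
by rewrite -[X in measurable X]setTI; exact: measurable_funP.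
Qed.

Lemma measurable_X_gt j x : measurable [set w | x < X j w].
Proof.
have -> : [set w | x < X j w] = ~` [set w | X j w <= x].
  by apply/seteqP; split=> w /=; rewrite ltNge => /negP.
by apply: measurableC; exact: measurable_X_le.
Qed.

Lemma prob_X_le j x : pr [set w | X j w <= x] = F x.
Proof.
have := marginal j x; rewrite /cdf /distribution /pushforward.
have -> : X j @^-1` `]-oo, x] = [set w | X j w <= x].
  by apply/seteqP; split=> w /=; rewrite in_itv.
by rewrite /prob => ->.
Qed.

Lemma prob_X_gt j x : pr [set w | x < X j w] = 1 - F x.
Proof.
have -> : [set w | x < X j w] = ~` [set w | X j w <= x].
  by apply/seteqP; split=> w /=; rewrite ltNge => /negP.
by rewrite probC ?prob_X_le//; exact: measurable_X_le.
Qed.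

Lemma F_itv x : 0 <= F x <= 1.
Proof.
by rewrite -(prob_X_le 0) prob_ge0 prob_le1//; exact: measurable_X_le.
Qed.

Lemma F_nondecreasing x y : x <= y -> F x <= F y.
Proof.
move=> xy; rewrite -!(prob_X_le 0); apply: le_prob; try exact: measurable_X_le.
by move=> w /= /le_trans; exact.
Qed.

Lemma bad_split n b j :
  bad n b j = [set w | X j w <= v b n] `|` [set w | u b n < X j w].
Proof.
apply/seteqP; split=> w; rewrite /bad/=.
  by move/negP; rewrite negb_and -leNgt -ltNge => /orP.
by case=> h; apply/negP; rewrite negb_and -leNgt -ltNge h ?orbT.
Qed.

Lemma prob_bad n b : v b n <= u b n ->
  pr (bad n b 0) = F (v b n) + (1 - F (u b n)).
Proof.
move=> vu; rewrite bad_split probU; [|exact: measurable_X_le|exact: measurable_X_gt].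
rewrite prob_X_le prob_X_gt (_ : _ `&` _ = set0) ?/prob ?measure0 ?subr0//.
by apply/seteqP; split=> w //= -[h1 h2]; lra.
Qed.

Lemma prob_bad_ge n b : F (v b n) <= pr (bad n b 0) /\ 1 - F (u b n) <= pr (bad n b 0).
Proof.
rewrite -(prob_X_le 0) -(prob_X_gt 0) bad_split.
have mX := measurable_X_le 0 (v b n); have mX' := measurable_X_gt 0 (u b n).
by split; apply: le_prob => //; exact: measurableU || exact: subsetUl || exact: subsetUr.
Qed.

(** A bad index is above the upper level or not above the lower one, so a pair
    of bad indices falls under one of the four cases of condition D'. *)
Lemma clusters_of_D' : condition_D' P X (u true) (v true) ->
  forall e : R, 0 < e -> exists K : nat, forall k, (K <= k)%N ->
  \forall n \near \oo, n%:R *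
    \sum_(1 <= h < (n %/ k).+1) pr (bad n true 0 `&` bad n true h) <= e.
Proof.
move=> D' e e0.
have e0E : (0 < e%:E)%E by rewrite lte_fin.
have [K _ HK] := D' _ (open_ereal_lt' e0E).
exists K => k /HK /=; move/limn_esup_lt; apply: filterS => n.
set f := fun j => _; set S := (\sum_(1 <= j < _) _)%E => lte.
have mle j x := measurable_X_le j x; have mgt j x := measurable_X_gt j x.
have SE : S = (\sum_(1 <= h < (n %/ k).+1)
  (pr ([set w | u true n < X 0%N w] `&` [set w | u true n < X h w]) +
   pr ([set w | u true n < X 0%N w] `&` [set w | X h w <= v true n]) +
   pr ([set w | X 0%N w <= v true n] `&` [set w | u true n < X h w]) +
   pr ([set w | X 0%N w <= v true n] `&` [set w | X h w <= v true n])))%:E.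
  rewrite -sumEFin; apply: eq_bigr => h _.
  by rewrite !EFinD -!probE//; exact: measurableI.
move: lte; rewrite SE -EFinM lte_fin => /ltW; apply: le_trans.
apply: ler_wpM2l => //; apply: ler_sum => h _.
set U0 := [set w | u true n < X 0%N w]; set V0 := [set w | X 0%N w <= v true n].
set Uh := [set w | u true n < X h w]; set Vh := [set w | X h w <= v true n].
have -> : bad n true 0 `&` bad n true h =
    ((U0 `&` Uh) `|` (U0 `&` Vh)) `|` ((V0 `&` Uh) `|` (V0 `&` Vh)).
  by rewrite !bad_split -!setIUr -setIUl setUC [Uh `|` _]setUC.
rewrite !probU; do ?[by repeat
  first [exact: mle|exact: mgt|apply: measurableI|apply: measurableU]].
have := prob_ge0 P ((U0 `&` Uh `|` U0 `&` Vh) `&` (V0 `&` Uh `|` V0 `&` Vh)).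
have := prob_ge0 P ((U0 `&` Uh) `&` (U0 `&` Vh)).
have := prob_ge0 P ((V0 `&` Uh) `&` (V0 `&` Vh)).
lra.
Qed.

(** Two runs of indices separated by the gap l n are admissible in condition D,
    whichever of the two pairs of levels each index is tested against. *)
Lemma mixing_of_D (l : nat) (alpha : R) n :
  mixing_bound P n l alpha
    (fun j => [set w | v false n < X j w <= u false n])
    (fun j => [set w | v true n < X j w <= u true n]) ->
  forall e s t, (s <= t <= n)%N ->
  `|pr (~` hit (mixed bad n e) 0 (s - l) `&` ~` hit (mixed bad n e) s t) -
    pr (~` hit (mixed bad n e) 0 (s - l)) * pr (~` hit (mixed bad n e) s t)|
  <= alpha.
Proof.
move=> mix e s t stn.
pose idx (b : bool) (p : pred nat) : {set 'I_n} :=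
  [set j : 'I_n | p j & (e j == b)]%SET.
pose p : pred nat := fun j => (0 <= j < s - l)%N.
pose q : pred nat := fun j => (s <= j < t)%N.
have disj r : (idx true r :&: idx false r = finset.set0)%SET.
  by apply/setP => j; rewrite !inE; case: (e j); rewrite ?andbF.
have gap (i j : 'I_n) : i \in (idx true p :|: idx false p)%SET ->
    j \in (idx true q :|: idx false q)%SET -> (i + l <= j)%N.
  by rewrite !inE /p /q; lia.
have idxU b : (idx b p :|: idx b q)%SET = idx b (predU p q).
  by apply/setP => j; rewrite !inE -andb_orl.
have := mix _ _ _ _ (disj p) (disj q) gap.
rewrite !idxU.
have mM j : measurable (mixed bad n e j) by exact: measurable_bad.
have jointE (r : pred nat) : (forall j, r j -> (j < n)%N) ->
    (\bigcap_(j in [set` idx true r]) [set w | v true n < X j w <= u true n])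
    `&` (\bigcap_(j in [set` idx false r])
          [set w | v false n < X j w <= u false n]) =
    [set w | forall j, r j -> ~ mixed bad n e j w].
  move=> rn; apply/seteqP; split=> w /=.
    move=> [w2 w1] j rj; apply.
    have jn := rn _ rj.
    case ej : (e j); [have := w2 (Ordinal jn)|have := w1 (Ordinal jn)];
      by rewrite /= inE /= rj ej; exact.
  move=> nh; split=> j; rewrite /= inE => /andP[rj /eqP ej];
    apply: contrapT => bj; apply: (nh _ rj);
    by rewrite /mixed ej.
have avoidE s1 t1 : ~` hit (mixed bad n e) s1 t1 =
    [set w | forall j, (s1 <= j < t1)%N -> ~ mixed bad n e j w].
  apply/seteqP; split=> w /= nh; last by case=> j /= jst; exact: nh.
  by move=> j jst Mj; apply: nh; exists j.
rewrite !jointE; [|by rewrite /p /q => j /=; lia..].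
rewrite -!avoidE (_ : [set w | _] = ~` hit (mixed bad n e) 0 (s - l) `&`
  ~` hit (mixed bad n e) s t); last first.
  rewrite !avoidE; apply/seteqP; split=> w /=.
    by move=> nh; split=> j jr; apply: nh; apply/orP; [left|right].
  by move=> [nh1 nh2] j /orP[/nh1|/nh2].
have mA s1 t1 := measurable_avoid _ mM s1 t1.
by rewrite !probE//; exact: measurableI.
Qed.

(** The inner interval lies in the outer one, so a selected index meets both
    constraints as soon as it meets the inner one.  When no index is selected, the
    endpoint convention makes the inner constraints hold. *)
Lemma selection_event_levels (eps : nat -> {RV P >-> bool}) n :
  (0 < n)%N -> 0 < F (u true n) -> F (v true n) < 1 ->
  u true n <= u false n -> v false n <= v true n ->
  [set w | [/\ ((v true n)%:E < selected_min F X eps n w)%E,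
               (selected_max F X eps n w <= (u true n)%:E)%E,
               ((v false n)%:E < minX X n w)%E
             & (maxX X n w <= (u false n)%:E)%E]] =
  selection_event bad eps n.
Proof.
move=> n0 Fu Fv uu vv.
have minE w : ((v false n)%:E < minX X n w)%E <->
    forall i : 'I_n, v false n < X i w.
  rewrite /minX; split=> [/bigmin_gtP[_ h] i|h].
    by have := h i isT; rewrite lte_fin.
  by apply/bigmin_gtP; split=> [|i _]; rewrite ?ltry// lte_fin.
have maxE w : (maxX X n w <= (u false n)%:E)%E <->
    forall i : 'I_n, X i w <= u false n.
  rewrite /maxX; split=> [/bigmax_leP[_ h] i|h].
    by have := h i isT; rewrite lee_fin.
  by apply/bigmax_leP; split=> [|i _]; rewrite ?leNye// lee_fin.
have none w : ~~ (0 < \sum_(i < n) eps i w)%N -> forall i : 'I_n, eps i w = false.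
  rewrite -eqn0Ngt sum_nat_eq0 => /forallP h i.
  by have := h i; case: (eps i w).
have sminE w : ((v true n)%:E < selected_min F X eps n w)%E <->
    forall i : 'I_n, eps i w -> v true n < X i w.
  rewrite /selected_min; case: ifPn => [_|/none no].
    split=> [/bigmin_gtP[_ h] i ei|h]; first by have := h i ei; rewrite lte_fin.
    by apply/bigmin_gtP; split=> [|i ei]; rewrite ?ltry// lte_fin h.
  split=> [_ i|_]; first by rewrite no.
  (* F is right-continuous, so F < 1 slightly to the right of the level. *)
  have : cdf (X 0%N) x @[x --> (v true n)^'+] --> cdf (X 0%N) (v true n).
    exact: cdf_right_continuous.
  have Fv1 : ((F (v true n))%:E < 1%:E)%E by rewrite lte_fin.
  rewrite marginal => /(_ _ (open_ereal_lt' Fv1)) near1.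
  have [x [vx Fx]] : exists x, v true n < x /\ F x < 1.
    near ((v true n)^'+) => x; exists x; split.
      by near: x; exact: nbhs_right_gt.
    by rewrite -lte_fin -(marginal 0); near: x.
  apply: (@lt_le_trans _ _ x%:E); first by rewrite lte_fin.
  by apply: ereal_sup_ubound; exists x.
have smaxE w : (selected_max F X eps n w <= (u true n)%:E)%E <->
    forall i : 'I_n, eps i w -> X i w <= u true n.
  rewrite /selected_max; case: ifPn => [_|/none no].
    split=> [/bigmax_leP[_ h] i ei|h]; first by have := h i ei; rewrite lee_fin.
    by apply/bigmax_leP; split=> [|i ei]; rewrite ?leNye// lee_fin h.
  split=> [_ i|_]; first by rewrite no.
  by apply: ereal_inf_lbound; exists (u true n).
apply/seteqP; split=> w /=.
  move=> [/sminE smin /smaxE smax /minE min /maxE max] [j /= jn]; apply.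
  have := smin (Ordinal jn); have := smax (Ordinal jn).
  have := min (Ordinal jn); have := max (Ordinal jn); rewrite /=.
  by case: (eps j w) => h1 h2 h3 h4; rewrite ?h1 ?h2 ?h3 ?h4.
move=> nh.
have ok (i : 'I_n) : v (eps i w) n < X i w <= u (eps i w) n.
  apply: contrapT => h; have : ~ hit (mixed bad n (eps ^~ w)) 0 n w by exact: nh.
  by apply; exists (nat_of_ord i); [rewrite /= ltn_ord|exact: h].
split; [apply/sminE|apply/smaxE|apply/minE|apply/maxE] => i.
- by have /andP[+ _] := ok i => /[swap] ->.
- by have /andP[_ +] := ok i => /[swap] ->.
- have /andP[+ _] := ok i; case: (eps i w) => // h; exact: le_lt_trans h.
- have /andP[_ +] := ok i; case: (eps i w) => // h; exact: le_trans uu.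
Unshelve. all: by end_near. Qed.

End levels.

(** * The limit *)

(** The limiting conditional probability, as a function of the selected fraction.
    Truncating the exponent makes it bounded and globally Lipschitz; for
    nonnegative rates this does not change it on [0, 1]. *)
Definition limit_law {R : realType} (t0 t1 x : R) : R :=
  expR (- Num.max 0 (x * t1 + (1 - x) * t0)).

Section limit_law.
Context {R : realType}.

Lemma limit_lawE (t0 t1 x : R) : 0 <= t0 -> 0 <= t1 -> 0 <= x <= 1 ->
  limit_law t0 t1 x = expR (- (x * t1 + (1 - x) * t0)).
Proof.
move=> t00 t10 /andP[x0 x1]; rewrite /limit_law max_r//.
by rewrite addr_ge0// mulr_ge0// subr_ge0.
Qed.

Lemma limit_law_itv (t0 t1 x : R) : 0 <= limit_law t0 t1 x <= 1.
Proof.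
by rewrite expR_ge0/= -expR0 ler_expR oppr_le0 le_max lexx.
Qed.

Lemma measurable_limit_law (t0 t1 : R) : measurable_fun setT (limit_law t0 t1).
Proof.
apply: measurableT_comp; first exact: measurable_expR.
apply: measurable_funN; apply: measurable_maxr; first exact: measurable_cst.
by apply: measurable_funD; apply: measurable_funM => //; exact: measurable_funB.
Qed.

Lemma limit_law_lipschitz (t0 t1 x y : R) :
  `|limit_law t0 t1 x - limit_law t0 t1 y| <= (`|t1 - t0| + 1) * `|x - y|.
Proof.
have m0 z : 0 <= Num.max 0 z :> R by rewrite le_max lexx.
apply: le_trans (expRN_lipschitz _ _ (m0 _) (m0 _)) _.
have max_lip (z w : R) : `|Num.max 0 z - Num.max 0 w| <= `|z - w|.
  rewrite ler_norml /Num.max; have := ler_norm (z - w).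
  have := ler_norm (- (z - w)); rewrite normrN.
  by case: ifPn; case: ifPn; rewrite -?leNgt => *; apply/andP; split; lra.
apply: le_trans (max_lip _ _) _.
have -> : x * t1 + (1 - x) * t0 - (y * t1 + (1 - y) * t0) =
  (t1 - t0) * (x - y) by ring.
by rewrite normrM ler_wpM2r// lerDl.
Qed.

End limit_law.

Theorem theorem2p1 (disp : measure_display) (T : measurableType disp)
    (R : realType)
    (P : probability T R)
    (X : nat -> {RV P >-> R}) (F : R -> R)
    (a b c d : nat -> R) (G H : cumulativeBounded (0 : R) (1 : R))
    (x1 x2 y1 y2 : R)
    (eps : nat -> {RV P >-> bool}) (calP : {RV P >-> R})
    (X_stationary : strictly_stationary P X)
    (F_marginal : forall (i : nat) (x : R), cdf (X i) x = (F x)%:E)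
    (a_gt0 : forall n : nat, (0 < n)%N -> 0 < a n)
    (c_gt0 : forall n : nat, (0 < n)%N -> 0 < c n)
    (G_nondegenerate : ~ degenerate_df G)
    (H_nondegenerate : ~ degenerate_df H)
    (F_max_domain : forall x : R,
      F (level a b n x) ^+ n @[n --> \oo] --> G x)
    (F_min_domain : forall y : R,
      (1 - F (level c d n y)) ^+ n @[n --> \oo] --> 1 - H y)
    (x2_lt_x1 : x2 < x1)
    (y1_lt_y2 : y1 < y2)
    (D_holds : condition_D P X (level a b ^~ x1) (level c d ^~ y1)
                               (level a b ^~ x2) (level c d ^~ y2))
    (D'_holds1 : condition_D' P X (level a b ^~ x1) (level c d ^~ y1))
    (D'_holds2 : condition_D' P X (level a b ^~ x2) (level c d ^~ y2))
    (eps_X_independent : independent_seqs P eps X)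
    (eps_mean_cvg : cvg_in_probability P
      (fun n w => (\sum_(i < n) (eps i w)%:R) / n%:R) calP)
    (calP_01 : {ae P, forall w, 0 <= calP w <= 1}) :
  P [set w | [/\ ((level c d n y2)%:E < selected_min F X eps n w)%E,
                 (selected_max F X eps n w <= (level a b n x2)%:E)%E,
                 ((level c d n y1)%:E < minX X n w)%E
               & (maxX X n w <= (level a b n x1)%:E)%E]]
    @[n --> \oo] -->
  'E_P[fun w => (G x2 `^ calP w * (1 - H y2) `^ calP w *
                 G x1 `^ (1 - calP w) * (1 - H y1) `^ (1 - calP w))%R]%E.
Proof.
pose u s n := level a b n (if s then x2 else x1).
pose v s n := level c d n (if s then y2 else y1).
pose B : nat -> bool -> nat -> set T := bad P X u v.
have mB : forall n s j, measurable (B n s j) by exact: measurable_bad.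
have clusters := clusters_of_D' P X u v D'_holds2.
have [M bounded] := rate_bounded P B mB _ _
  (stationary_bad P X X_stationary u v) (stationary_badI P X X_stationary u v)
  clusters.
have uu n : (0 < n)%N -> u true n <= u false n.
  by move=> n0; rewrite /u /level lerD2r ler_pM2l ?ltW// a_gt0.
have vv n : (0 < n)%N -> v false n <= v true n.
  by move=> n0; rewrite /v /level lerD2r ler_pM2l ?ltW// c_gt0.
have Fbnd x := F_itv P X F F_marginal x.
have Fmon x y := F_nondecreasing P X F F_marginal x y.
have rate (s : nat -> R) (g : R) : (forall n, 0 <= s n <= 1) ->
    (forall n, (0 < n)%N -> s n <= prob P (B n true 0)) ->
    (1 - s n) ^+ n @[n --> \oo] --> g ->
    0 < g /\ n%:R * s n @[n --> \oo] --> - ln g.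
  move=> s01 sp; apply: (@cvg_rate_of_exprn _ _ M) => //.
  near=> n; apply: (@le_trans _ _ (n%:R * prob P (B n true 0))).
    by apply: ler_wpM2l => //; apply: sp; near: n; exact: nbhs_infty_gt.
  by near: n.
have upper s : 0 < G (if s then x2 else x1) /\
    n%:R * (1 - F (u s n)) @[n --> \oo] --> - ln (G (if s then x2 else x1)).
  apply: (rate (fun n => 1 - F (u s n))).
  - by move=> n; have := Fbnd (u s n); lra.
  - move=> n n0; have [_] := prob_bad_ge P X F F_marginal u v n true.
    apply: le_trans; rewrite lerD2l lerN2; apply: Fmon.
    by case: s => //; exact: uu.
  - by under eq_fun do rewrite subKr; exact: F_max_domain.
have lower s : 0 < 1 - H (if s then y2 else y1) /\
    n%:R * F (v s n) @[n --> \oo] --> - ln (1 - H (if s then y2 else y1)).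
  apply: (rate (fun n => F (v s n))) => //.
    move=> n n0; have [+ _] := prob_bad_ge P X F F_marginal u v n true.
    apply: le_trans; apply: Fmon.
    by case: s => //; exact: vv.
  exact: F_min_domain.
(* F tends to 0 along the lower levels and to 1 along the upper ones: for large n
   the levels do not cross, the upper one is past the left endpoint of F, and the
   lower one is before its right endpoint. *)
have half : \forall n \near \oo, F (v true n) < 2^-1 < F (u true n).
  have small (z : nat -> R) (l : R) : n%:R * z n @[n --> \oo] --> l ->
      \forall n \near \oo, z n < 2^-1.
    move=> zl.
    have z0 : z n @[n --> \oo] --> (0 : R).
      rewrite -(mul0r l); apply: cvg_trans; last exact: (cvgM cvg_natrV zl).
      apply: near_eq_cvg; near=> n; rewrite /= mulKf// pnatr_eq0 -lt0n.
      by near: n; exact: nbhs_infty_gt.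
    by have /cvgr_lt := z0; apply; rewrite invr_gt0.
  have [_ /small lo] := lower true; have [_ /small up] := upper true.
  near=> n; apply/andP; split; first by near: n.
  have : 1 - F (u true n) < 2^-1 by near: n.
  by lra.
pose tau s := - ln (G (if s then x2 else x1)) - ln (1 - H (if s then y2 else y1)).
have rateB s : n%:R * prob P (B n s 0) @[n --> \oo] --> tau s.
  have [_ up] := upper s; have [_ lo] := lower s.
  rewrite /tau addrC; apply: cvg_trans; last exact: (cvgD lo up).
  apply: near_eq_cvg; near=> n.
  have n0 : (0 < n)%N by near: n; exact: nbhs_infty_gt.
  have /andP[h1 h2] : F (v true n) < 2^-1 < F (u true n) by near: n.
  have vu : v true n <= u true n.
    by rewrite leNgt; apply/negP => /ltW/Fmon; lra.
  rewrite /= /B (prob_bad P X F F_marginal) ?[RHS]mulrDr//.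
  by case: s {up lo} => //; exact: le_trans (vv n n0) (le_trans vu (uu n n0)).
have tau0 s : 0 <= tau s.
  by apply: (cvgr_to_ge (rateB s)); apply: nearW => n; rewrite mulr_ge0 ?prob_ge0.
have subB n s j : (0 < n)%N -> B n s j `<=` B n true j.
  move=> n0; case: s => //; apply: subsetC => w /= /andP[h1 h2].
  by rewrite (le_lt_trans (vv n n0) h1)/= (le_trans h2 (uu n n0)).
have [l [alpha [_ _ l0 alpha0 mix]]] := D_holds.
have mixing n e s t : (0 < n)%N -> (s <= t <= n)%N ->
    `|prob P (~` hit (mixed B n e) 0 (s - l n) `&` ~` hit (mixed B n e) s t) -
      prob P (~` hit (mixed B n e) 0 (s - l n)) *
      prob P (~` hit (mixed B n e) s t)| <= alpha n.
  move=> n0; have [mix1 _ _] := mix n n0.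
  exact: (mixing_of_D P X u v (l n) (alpha n) n mix1).
have uniform eta : 0 < eta -> \forall n \near \oo, forall e,
    `|prob P (~` hit (mixed B n e) 0 n) -
      limit_law (tau false) (tau true) (selected_fraction n e)| <= eta.
  move=> eta0; have := uniform_poisson_limit P B mB subB _ _
    (stationary_bad P X X_stationary u v) (stationary_badI P X X_stationary u v)
    clusters l alpha tau l0 alpha0 mixing rateB eta eta0.
  apply: filterS => n close e.
  by rewrite limit_lawE// selected_fraction_itv.
have main : prob P (selection_event B eps n) @[n --> \oo] -->
    (\int[P]_w limit_law (tau false) (tau true) (calP w))%R.
  apply: (cvg_selection_event P B X eps mB _ _ eps_X_independent _ _
    (`|tau true - tau false| + 1)) => //.
  - by move=> n s j; exact: sigma_of_seq_bad.
  - exact: measurable_limit_law.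
  - exact: limit_law_itv.
  - exact: limit_law_lipschitz.
have prodE : (fun w => G x2 `^ calP w * (1 - H y2) `^ calP w *
      G x1 `^ (1 - calP w) * (1 - H y1) `^ (1 - calP w)) =
    (fun w => expR (- (calP w * tau true + (1 - calP w) * tau false))).
  apply/funext => w.
  have [G2 _] := upper true; have [G1 _] := upper false.
  have [H2 _] := lower true; have [H1 _] := lower false.
  rewrite /powR !gt_eqF// -!expRD; congr expR; rewrite /tau; ring.
have meanE :
    'E_P[fun w => expR (- (calP w * tau true + (1 - calP w) * tau false))]%E =
    ((\int[P]_w limit_law (tau false) (tau true) (calP w))%R)%:E.
  have mlaw : measurable_fun setT
      (fun w => limit_law (tau false) (tau true) (calP w)).
    by apply: measurableT_comp => //; exact: measurable_limit_law.
  rewrite unlock /Rintegral fineK; last first.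
    apply: integrable_fin_num => //; apply: integrable_itv01 => // w.
    exact: limit_law_itv.
  apply: ae_eq_integral => //.
  - apply/measurable_EFinP; apply: measurableT_comp => //.
    by apply: measurable_funN; apply: measurable_funD; apply: measurable_funM;
      rewrite //; exact: measurable_funB.
  - by apply/measurable_EFinP; exact: mlaw.
  - by apply: filterS calP_01 => w P01 _; rewrite limit_lawE.
have mainE : (prob P (selection_event B eps n))%:E @[n --> \oo] -->
    ((\int[P]_w limit_law (tau false) (tau true) (calP w))%R)%:E.
  by apply: cvg_EFin; [exact: nearW|exact: main].
rewrite prodE meanE; apply: cvg_trans mainE; apply: near_eq_cvg; near=> n.
have n0 : (0 < n)%N by near: n; exact: nbhs_infty_gt.
have /andP[h1 h2] : F (v true n) < 2^-1 < F (u true n) by near: n.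
rewrite -probE; last by apply: measurable_selection_event.
rewrite -(selection_event_levels P X F F_marginal u v)//; try lra.
- exact: uu.
- exact: vv.
Unshelve. all: by end_near. Qed.
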